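(* The planar fertility map $\Phi_{\mathrm{fer}}:\bigl(\mathrm{PSL}(A),\curvearrowright_l,[-,-]_{\cdot}\bigr)\to\bigl(\mathfrak g(A),\blacktriangleright_w,[-,-]_{\cdot}\bigr)$ is a post-Lie algebra isomorphism.
   Context: $\mathbf{k}$ is a field of characteristic zero and $A$ is a finite set. Post-Lie algebra. A post-Lie algebra $(\mathbf g,\blacktriangleright,[-,-])$ is a Lie algebra $(\mathbf g,[-,-])$ with a bilinear product $\blacktriangleright$ such that for all $x,y,z$: $x\blacktriangleright[y,z]=[x\blacktriangleright y,z]+[y,x\blacktriangleright z]$ and $[x,y]\blacktriangleright z=a_\blacktriangleright(x,y,z)-a_\blacktriangleright(y,x,z)$, where $a_\blacktriangleright(x,y,z)=x\blacktriangleright(y\blacktriangleright z)-(x\blacktriangleright y)\blacktriangleright z$. A post-Lie isomorphism is a linear bijection preserving both operations. Word side. $\mathcal Z_A=\{z_i^a \mid a\in A,\ i\in\mathbb Z_{\ge -1}\}$ and $\overline{\mathrm{PN}}(A)=\mathbf{k}\langle \mathcal Z_A\rangle$ is the free unital associative algebra. The weight is $\mathrm{wt}(z_i^a)=i$, additive on words. $\overline{\mathrm{PN}}(A)_{\le 0}$ is the span of the monomials of weight $\le 0$, a Lie algebra for the commutator $[x,y]_{\cdot}=xy-yx$. On letters $\partial(z_i^a)=z_{i+1}^a$. $V(A)$ is the linear span of the monomials $z_{i_1}^{a_1}\cdots z_{i_p}^{a_p}$ with $\sum_{r=1}^p i_r=-1$ and $\sum_{r=1}^q i_r\ge 0$ for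 $1\le q<p$. $\mathfrak g(A)$ is the Lie subalgebra of $\overline{\mathrm{PN}}(A)_{\le 0}$ generated by $V(A)$. For monomials $\mathbf x$, $\mathbf y=y_1\cdots y_q$ of weight $\le0$, $$\mathbf x\blacktriangleright_w\mathbf y=\sum_{j=1}^q y_1\cdots y_{j-1}\,\partial^{-\mathrm{wt}(\mathbf x)}(y_j)\,\mathbf x\,y_{j+1}\cdots y_q,$$ extended bilinearly; it restricts to $\mathfrak g(A)$ and makes $(\mathfrak g(A),\blacktriangleright_w,[-,-]_{\cdot})$ a post-Lie algebra. Tree side. $\mathcal{OT}^A$ is the set of $A$-decorated planar rooted trees, $\mathcal{OF}^A$ the set of finite ordered sequences (forests) of such trees, including the empty one; $\mathbf{k}\,\mathcal{OF}^A$ with concatenation is the free associative algebra on $\mathcal{OT}^A$. $\mathrm{PSL}(A)=\mathrm{Lie}(\mathbf{k}\,\mathcal{OT}^A)\subseteq \mathbf{k}\,\mathcal{OF}^A$ is the free Lie algebra on $\mathcal{OT}^A$ with commutator bracket $[-,-]_{\cdot}$. For trees $s,t$, the left grafting is $s\curvearrowright_l t=\sum_{v\in V(t)}s\curvearrowright_v t$, where $s\curvearrowright_v t$ is obtained by attaching the root of $s$ to $v$ by a new edge as the leftmost child of $v$; $\curvearrowright_l$ is extended to $\mathrm{PSL}(A)$ by the post-Lie axioms, and $(\mathrm{PSL}(A),\curvearrowright_l,[-,-]_{\cdot})$ is the free post-Lie algebra on $A$. Fertility map. The root-subtree order on the vertices of a planar rooted tree lists the root first, then the vertices of the subtrees attached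 to the root from left to right, each ordered recursively. With $d(v)$ the decoration and $f(v)$ the number of children of $v$, and $v_1<\dots<v_p$ the vertices of $t$ in this order, $\Phi_{\mathrm{fer}}^{\mathcal T}(t)=z_{f(v_1)-1}^{d(v_1)}\cdots z_{f(v_p)-1}^{d(v_p)}\in V(A)$. It extends to the algebra morphism $\Phi_{\mathrm{fer}}^{\mathcal F}:\mathbf{k}\,\mathcal{OF}^A\to\overline{\mathrm{PN}}(A)_{\le0}$, $t_1\cdots t_m\mapsto\Phi_{\mathrm{fer}}^{\mathcal T}(t_1)\cdots\Phi_{\mathrm{fer}}^{\mathcal T}(t_m)$, and $\Phi_{\mathrm{fer}}$ is the restriction of $\Phi_{\mathrm{fer}}^{\mathcal F}$ to $\mathrm{PSL}(A)$, with values in $\mathfrak g(A)$. *)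

(* Defs.v *)
From HB Require Import structures.
From mathcomp Require Import all_boot all_order all_algebra.
From mathcomp Require Import finmap monalg.

Set Implicit Arguments.
Unset Strict Implicit.
Unset Printing Implicit Defensive.

Import GRing.Theory.
Local Open Scope ring_scope.

(* Lie and post-Lie algebras are carried by a linear subspace P of a module V; *)
(* the operations are functions on V of which only the restriction to P is     *)
(* constrained.                                                                *)
Section PostLie.
Context {k : fieldType} {V : lmodType k}.
Implicit Types (P : V -> Prop) (op br tri : V -> V -> V).

Record subspace P : Prop := Subspace {
  subspace0 : P 0;
  subspace_linear : forall (c : k) x y, P x -> P y -> P (c *: x + y)
}.

Record bilinear_on P op : Prop := BilinearOn {
  bilinear_closed : forall x y, P x -> P y -> P (op x y);
  bilinearl : forall (c : k) x y z, P x -> P y -> P z ->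
    op (c *: x + y) z = c *: op x z + op y z;
  bilinearr : forall (c : k) x y z, P x -> P y -> P z ->
    op z (c *: x + y) = c *: op z x + op z y
}.

Record lie_algebra P br : Prop := LieAlgebra {
  lie_subspace : subspace P;
  lie_bilinear : bilinear_on P br;
  lie_alternating : forall x, P x -> br x x = 0;
  lie_jacobi : forall x y z, P x -> P y -> P z ->
    br x (br y z) + br y (br z x) + br z (br x y) = 0
}.

Definition associator op x y z := op x (op y z) - op (op x y) z.

Record post_lie_algebra P tri br : Prop := PostLieAlgebra {
  post_lie_lie : lie_algebra P br;
  post_lie_bilinear : bilinear_on P tri;
  post_lie_derivation : forall x y z, P x -> P y -> P z ->
    tri x (br y z) = br (tri x y) z + br y (tri x z);
  post_lie_associator : forall x y z, P x -> P y -> P z ->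
    tri (br x y) z = associator tri x y z - associator tri y x z
}.

(* The Lie subalgebra generated by S, for the bracket br.                      *)
Inductive lie_gen br (S : V -> Prop) : V -> Prop :=
| LieGen_mem x of S x : lie_gen br S x
| LieGen_zero : lie_gen br S 0
| LieGen_linear (c : k) x y of lie_gen br S x & lie_gen br S y :
    lie_gen br S (c *: x + y)
| LieGen_bracket x y of lie_gen br S x & lie_gen br S y :
    lie_gen br S (br x y).

End PostLie.

Section PostLieUnique.
Context {k : fieldType} {V : lmodType k} (br : V -> V -> V) (S : V -> Prop).
Local Notation P := (lie_gen br S).

Inductive homogeneous : nat -> V -> Prop :=
| Hom_mem x of S x : homogeneous 1 x
| Hom_zero n of (0 < n)%N : homogeneous n 0
| Hom_linear n (c : k) x y of homogeneous n x & homogeneous n y :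
    homogeneous n (c *: x + y)
| Hom_bracket m n x y of homogeneous m x & homogeneous n y :
    homogeneous (m + n) (br x y).

Lemma homogeneous_gt0 n x : homogeneous n x -> (0 < n)%N.
Proof. by elim=> // m p y z _ m0 _ _; rewrite addn_gt0 m0. Qed.

Lemma homogeneous_lie_gen n x : homogeneous n x -> P x.
Proof.
elim=> {n x} [x|||].
- exact: LieGen_mem.
- by move=> *; apply: LieGen_zero.
- by move=> *; apply: LieGen_linear.
- by move=> *; apply: LieGen_bracket.
Qed.

Hypothesis lieP : lie_algebra P br.

Lemma bilinear0l op z : bilinear_on P op -> P z -> op 0 z = 0.
Proof.
move=> [_ L _] Pz; have P0 : P 0 by apply: LieGen_zero.
by rewrite -[X in op X](addNr 0) -scaleN1r L // scaleN1r addNr.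
Qed.

Lemma bilinear0r op z : bilinear_on P op -> P z -> op z 0 = 0.
Proof.
move=> [_ _ L] Pz; have P0 : P 0 by apply: LieGen_zero.
by rewrite -[X in op _ X](addNr 0) -scaleN1r L // scaleN1r addNr.
Qed.

Lemma lie_gen_homogeneous_ind (Q : V -> Prop) :
  Q 0 -> (forall c x y, P x -> P y -> Q x -> Q y -> Q (c *: x + y)) ->
  (forall n x, homogeneous n x -> Q x) -> forall x, P x -> Q x.
Proof.
move=> Q0 QL QH x Px.
pose R0 y := forall R : V -> Prop, R 0 ->
  (forall c u v, P u -> P v -> R u -> R v -> R (c *: u + v)) ->
  (forall n u, homogeneous n u -> R u) -> R y.
suff Rx : R0 x by apply: Rx.
have [bC bL bR] := lie_bilinear lieP.
elim: Px => {x} [x Sx||c x y Px Rx Py Ry|x y Px Rx Py Ry] R r0 RL RH.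
- by apply: (RH 1%N); apply: Hom_mem.
- by [].
- exact: (RL c x y Px Py (Rx R r0 RL RH) (Ry R r0 RL RH)).
apply: (Rx (fun x => R (br x y))).
- by rewrite (bilinear0l (lie_bilinear lieP)).
- move=> c u v Pu Pv Ru Rv; rewrite bL //; apply: RL => //; exact: bC.
move=> m u Hu; have Pu := homogeneous_lie_gen Hu.
apply: (Ry (fun y => R (br u y))).
- by rewrite (bilinear0r (lie_bilinear lieP)) //; apply: homogeneous_lie_gen Hu.
- move=> c v w Pv Pw Rv Rw; rewrite bR //; apply: RL => //; exact: bC.
by move=> n v Hv; apply: (RH (m + n)%N); apply: Hom_bracket.
Qed.

(* A post-Lie product on the Lie algebra generated by S is determined by its   *)
(* values on S, as soon as these lie in S.                                     *)
Lemma post_lie_unique (tri tri' : V -> V -> V) :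
  post_lie_algebra P tri br -> post_lie_algebra P tri' br ->
  (forall x y, S x -> S y -> S (tri x y)) ->
  (forall x y, S x -> S y -> tri x y = tri' x y) ->
  forall x y, P x -> P y -> tri x y = tri' x y.
Proof.
move=> [_ B D As] [_ B' D' As'] ScS eqS.
have [tC tL tR] := B; have [tC' tL' tR'] := B'.
have step x : P x -> (forall y, S y -> tri x y = tri' x y) ->
    forall y, P y -> tri x y = tri' x y.
  move=> Px xS y; elim=> {y} [y /xS //||c y z Py Ey Pz Ez|y z Py Ey Pz Ez].
  - by rewrite !bilinear0r.
  - by rewrite tR // tR' // Ey Ez.
  - by rewrite D // D' // Ey Ez.
have degr x : P x -> (forall y, S y -> homogeneous 1 (tri x y)) ->
    forall n y, homogeneous n y -> homogeneous n (tri x y).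
  move=> Px xS n y; elim=> {n y} [y /xS //|n n0|n c y z Hy Ey Hz Ez
                                 |m n y z Hy Ey Hz Ez].
  - by rewrite bilinear0r //; apply: Hom_zero.
  - have [Py Pz] := (homogeneous_lie_gen Hy, homogeneous_lie_gen Hz).
    by rewrite tR //; apply: Hom_linear.
  - have [Py Pz] := (homogeneous_lie_gen Hy, homogeneous_lie_gen Hz).
    rewrite D // -[br (tri x y) z]scale1r.
    by apply: Hom_linear; apply: Hom_bracket.
have main n : forall N x, homogeneous N x -> (N <= n)%N ->
    (forall y, S y -> homogeneous 1 (tri x y)) /\
    (forall y, S y -> tri x y = tri' x y).
  elim: n => [|n IHn] N x Hx; first by rewrite leqNgt (homogeneous_gt0 Hx).
  elim: Hx => {N x} [x Sx _|N _ _|N c x y Hx IHx Hy IHy leN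
                    |N M x y Hx _ Hy _ leNM].
  - by split=> y Sy; [apply: Hom_mem; apply: ScS|apply: eqS].
  - split=> y Sy; have Py : P y by apply: LieGen_mem.
      by rewrite bilinear0l //; apply: Hom_zero.
    by rewrite !bilinear0l.
  - have [Px Py] := (homogeneous_lie_gen Hx, homogeneous_lie_gen Hy).
    have [[Hx1 Ex] [Hy1 Ey]] := (IHx leN, IHy leN).
    split=> z Sz; have Pz : P z by apply: LieGen_mem.
      by rewrite tL //; apply: Hom_linear; [apply: Hx1|apply: Hy1].
    by rewrite tL // tL' // Ex // Ey.
  have [Px Py] := (homogeneous_lie_gen Hx, homogeneous_lie_gen Hy).
  have [N0 M0] := (homogeneous_gt0 Hx, homogeneous_gt0 Hy).
  have leN : (N <= n)%N.
    by rewrite -ltnS; apply: leq_trans leNM; rewrite -addn1 leq_add2l.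
  have leM : (M <= n)%N.
    by rewrite -ltnS; apply: leq_trans leNM; rewrite -add1n leq_add2r.
  have [Hx1 Ex] := IHn _ _ Hx leN; have [Hy1 Ey] := IHn _ _ Hy leM.
  have [Hxy Hyx] := (degr _ Px Hx1 _ _ Hy, degr _ Py Hy1 _ _ Hx).
  have [Hxy1 Exy] := IHn _ _ Hxy leM; have [Hyx1 Eyx] := IHn _ _ Hyx leN.
  have [Pxy Pyx] := (tC _ _ Px Py, tC _ _ Py Px).
  split=> z Sz; have Pz : P z by apply: LieGen_mem.
    have homB u v : homogeneous 1 u -> homogeneous 1 v -> homogeneous 1 (u - v).
      by move=> Hu Hv; rewrite addrC -scaleN1r; apply: Hom_linear.
    rewrite As // /associator; apply: (homB _ _); apply: (homB _ _).
    - by apply: degr => //; apply: Hy1.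
    - exact: Hxy1.
    - by apply: degr => //; apply: Hx1.
    - exact: Hyx1.
  have Eg u : P u -> tri x u = tri' x u by apply: step.
  have Eh u : P u -> tri y u = tri' y u by apply: step.
  rewrite As // As' // /associator (Ey z Sz) (Ex z Sz) (Exy z Sz) (Eyx z Sz).
  rewrite -(Eg y) // -(Eh x) //.
  by rewrite Eg ?Eh //; [apply: tC'|apply: tC'].
move=> x y Px; move: x Px y.
apply: lie_gen_homogeneous_ind => [y Py|c x y Px Py Ex Ey z Pz|n x Hx].
- by rewrite !bilinear0l.
- by rewrite tL // tL' // Ex // Ey.
apply: step; first exact: homogeneous_lie_gen Hx.
by have [] := main _ _ _ Hx (leqnn n).
Qed.

End PostLieUnique.

Record post_lie_isomorphism (k : fieldType) (V W : lmodType k)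
    (P : V -> Prop) (triP brP : V -> V -> V)
    (Q : W -> Prop) (triQ brQ : W -> W -> W) (f : V -> W) : Prop :=
  PostLieIsomorphism {
    iso_source : post_lie_algebra P triP brP;
    iso_target : post_lie_algebra Q triQ brQ;
    iso_into : forall x, P x -> Q (f x);
    iso_linear : forall (c : k) x y, P x -> P y ->
      f (c *: x + y) = c *: f x + f y;
    iso_injective : forall x y, P x -> P y -> f x = f y -> x = y;
    iso_surjective : forall y, Q y -> exists2 x, P x & f x = y;
    iso_bracket : forall x y, P x -> P y -> f (brP x y) = brQ (f x) (f y);
    iso_product : forall x y, P x -> P y -> f (triP x y) = triQ (f x) (f y)
  }.

(* {malg k[{fmonom X}]} is the free unital associative algebra on X, with     *)
(* basis the words FMonom s for s : seq X.                                     *)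
Section FreeAlgebra.
Context {k : fieldType} {X : choiceType}.
Implicit Types (x y : {malg k[{fmonom X}]}).

Definition word (s : seq X) : {malg k[{fmonom X}]} := << FMonom s >>.

Definition linext (W : lmodType k) (f : seq X -> W) x : W :=
  \sum_(m <- msupp x) x@_m *: f m.

Definition word_span (S : pred (seq X)) x : Prop :=
  forall m, m \in msupp x -> S m.

Definition commutator x y := x * y - y * x.

End FreeAlgebra.

Section PlanarTrees.
Context {A : finType}.

Inductive otree := Node of A & seq otree.

Fixpoint otree_encode (t : otree) : GenTree.tree A :=
  let: Node a ts := t in
  GenTree.Node 0 (GenTree.Leaf a :: map otree_encode ts).

Fixpoint otree_decode (t : GenTree.tree A) : option otree :=
  if t is GenTree.Node _ (GenTree.Leaf a :: us)
  then Some (Node a (pmap otree_decode us)) else None.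

Fixpoint otree_encodeK (t : otree) :
  otree_decode (otree_encode t) = Some t.
Proof.
case: t => a ts /=; congr (Some (Node a _)).
by elim: ts => [//|t ts IH] /=; rewrite otree_encodeK /= IH.
Qed.

HB.instance Definition _ :=
  Choice.copy otree (pcan_type (otree_encodeK : pcancel _ _)).

(* The vertices of a tree, in root-subtree order; a vertex is the path of      *)
(* child positions leading to it from the root.                                *)
Fixpoint vertices (t : otree) : seq (seq nat) :=
  let: Node _ ts := t in
  [::] :: flatten [seq [seq iv.1 :: v | v <- iv.2]
                  | iv <- zip (iota 0 (size ts)) (map vertices ts)].

(* s grafted on t at v, as leftmost child of v.                                *)
Fixpoint graft_at (s : otree) (v : seq nat) (t : otree) : otree :=
  let: Node a ts := t in
  if v is i :: v' then
    if drop i ts is u :: us then Node a (take i ts ++ graft_at s v' u :: us)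
    else t
  else Node a (s :: ts).

End PlanarTrees.
Arguments otree A : clear implicits.

Section TreeSide.
Context {k : fieldType} {A : finType}.

Definition forest_algebra := {malg k[{fmonom otree A}]}.
Implicit Types (x y : forest_algebra) (s t : otree A) (F G : seq (otree A)).

Definition PSL : forest_algebra -> Prop :=
  lie_gen commutator (word_span (fun F => size F == 1%N)).

Definition tree_graft s t : forest_algebra :=
  \sum_(v <- vertices t) word [:: graft_at s v t].

(* The derivation of the forest algebra extending tree_graft s.                *)
Definition tree_graft_der s : forest_algebra -> forest_algebra :=
  linext (fun G => \sum_(j < size G)
    word (take j G) * tree_graft s (tnth (in_tuple G) j) * word (drop j.+1 G)).

(* The second post-Lie axiom determines x -> (x curvearrowright _) on brackets; *)
(* it is obtained by antisymmetrizing, for commutators of elements of PSL, the *)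
(* enveloping algebra recursion (Guin-Oudom)                                   *)
(*    (s F) > y = s > (F > y) - (s > F) > y        (s a tree, F a forest),     *)
(* which is used here as definition. As s > F is a combination of forests of   *)
(* the same length as F, the recursion is on the length n of the forest.       *)
Fixpoint forest_graft (n : nat) F y : forest_algebra :=
  match n, F with
  | _, [::] => y
  | 0, _ :: _ => 0
  | n'.+1, s :: F' =>
      tree_graft_der s (forest_graft n' F' y)
      - linext (fun G => forest_graft n' G y) (tree_graft_der s (word F'))
  end.

Definition left_graft x y : forest_algebra :=
  linext (fun F => forest_graft (size F) F y) x.

End TreeSide.
Arguments forest_algebra k A : clear implicits.
Arguments PSL k A : clear implicits.

Section LeftGraftSpec.
Context {k : fieldType} {A : finType}.
Implicit Types (s t : otree A).

Lemma linext_word (X : choiceType) (W : lmodType k) (f : seq X -> W) F :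
  linext f (word F) = f F.
Proof.
by rewrite /linext /word msuppU oner_eq0 big_seq_fset1 mcoeffUU scale1r.
Qed.

Lemma linext0 (X : choiceType) (W : lmodType k) (f : seq X -> W) :
  linext f 0 = 0.
Proof. by rewrite /linext msupp0 big_seq_fset0. Qed.

Lemma word_span_subspace (X : choiceType) (S : pred (seq X)) :
  subspace (@word_span k X S).
Proof.
split=> [m|c x y Sx Sy m]; first by rewrite msupp0.
move/(fsubsetP (msuppD_le _ _)); rewrite inE => /orP[|/Sy //].
by move/(fsubsetP (msuppZ_le _ _))/Sx.
Qed.

Lemma word_span_word (X : choiceType) (S : pred (seq X)) F :
  S F -> word_span S (@word k X F).
Proof. by move=> SF m; rewrite /word msuppU oner_eq0 inE => /eqP ->. Qed.

Lemma word_span_ind (X : choiceType) (S : pred (seq X))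
    (Q : {malg k[{fmonom X}]} -> Prop) :
  Q 0 -> (forall F, S F -> Q (word F)) ->
  (forall c x y, word_span S x -> word_span S y -> Q x -> Q y ->
    Q (c *: x + y)) ->
  forall x, word_span S x -> Q x.
Proof.
move=> Q0 QS QL x Sx; have [S0 SL] := word_span_subspace S.
rewrite [x]monalgE big_seq.
suff [] : word_span S (\sum_(m <- msupp x | m \in msupp x) << x@_m *g m >>) /\
    Q (\sum_(m <- msupp x | m \in msupp x) << x@_m *g m >>) by [].
elim/big_rec: _ => [//|m y /Sx mS [Sy Qy]].
have -> : << x@_m *g m >> = x@_m *: word m :> {malg k[{fmonom X}]}.
  case: m {mS} => F; apply/malgP => w.
  by rewrite mcoeffZ !mcoeffU mulrnAr mulr1.
have Sm := word_span_word mS.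
by split; [apply: SL|apply: QL => //; apply: QS].
Qed.

Lemma left_graft_tree s t : left_graft (word [:: s]) (word [:: t])
  = \sum_(v <- vertices t) word [:: graft_at s v t] :> forest_algebra k A.
Proof.
rewrite /left_graft linext_word /= {2}/tree_graft_der linext_word big_ord0.
rewrite linext0 subr0 /tree_graft_der linext_word big_ord1 /=.
have -> : word [::] = 1 :> forest_algebra k A by rewrite /word -fmoneE.
by rewrite mul1r mulr1 (tnth_nth s).
Qed.

(* left_graft is the only post-Lie product on PSL extending the left grafting  *)
(* of trees.                                                                   *)
Lemma left_graft_unique (op : forest_algebra k A -> _ -> _) :
  post_lie_algebra (PSL k A) (@left_graft k A) (@commutator k _) ->
  post_lie_algebra (PSL k A) op (@commutator k _) ->
  (forall s t, op (word [:: s]) (word [:: t])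
     = \sum_(v <- vertices t) word [:: graft_at s v t]) ->
  forall x y, PSL k A x -> PSL k A y -> op x y = left_graft x y.
Proof.
move=> L1 L2 opE x y Px Py; apply/esym; move: x y Px Py.
have [[L B _ _] _] := (L1, L2).
have [_ tL tR] := B; have [_ [_ oL oR] _ _] := L2.
have inP (u : forest_algebra k A) :
    word_span (fun F => size F == 1) u -> PSL k A u by apply: LieGen_mem.
have [S0 SL] := @word_span_subspace (otree A) (fun F => size F == 1%N).
have key s t : left_graft (word [:: s]) (word [:: t])
    = op (word [:: s]) (word [:: t]) by rewrite left_graft_tree opE.
apply: (post_lie_unique L) => //.
- move=> x y Sx; move: x Sx y; apply: word_span_ind => [y Sy|[|s []] // _ y|c x y Sx Sy Ex Ey z Sz].
  + by rewrite (bilinear0l B) //; apply: inP.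
  + have Ps : PSL k A (word [:: s]) by apply/inP/word_span_word.
    move: y; apply: word_span_ind => [|[|t []] // _|c y z Sy Sz Ey Ez].
    * by rewrite (bilinear0r B).
    * rewrite left_graft_tree; elim/big_rec: _ => // v z _ Sz.
      by rewrite -[word _]scale1r; apply: SL => //; apply: word_span_word.
    * by rewrite tR //; [apply: SL|apply: inP|apply: inP].
  + by rewrite tL; [apply: SL; [apply: Ex|apply: Ey]| | |]; try exact: inP.
- have oB := post_lie_bilinear L2.
  move=> x y Sx; move: x Sx y; apply: word_span_ind => [y Sy|[|s []] // _ y|c x y Sx Sy Ex Ey z Sz].
  + by rewrite (bilinear0l B) ?(bilinear0l oB) //; apply: inP.
  + have Ps : PSL k A (word [:: s]) by apply/inP/word_span_word.
    move: y; apply: word_span_ind => [|[|t []] // _|c y z Sy Sz Ey Ez].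
    * by rewrite (bilinear0r B) ?(bilinear0r oB).
    * by rewrite tR ?oR ?Ey ?Ez //; apply: inP.
  + by rewrite tL ?oL ?Ex ?Ey //; apply: inP.
Qed.

End LeftGraftSpec.

Section WordSide.
Context {k : fieldType} {A : finType}.

(* The letter z_i^a, i >= -1, is encoded as (a, i + 1).                        *)
Definition letter := (A * nat)%type.
Definition word_algebra := {malg k[{fmonom letter}]}.
Implicit Types (z : letter) (s r : seq letter).

Definition wt s : int := \sum_(z <- s) (z.2%:Z - 1).

Definition shift (m : nat) z : letter := (z.1, (z.2 + m)%N).

Definition V_word s : bool :=
  (wt s == -1) && [forall q : 'I_(size s), (0 < q)%N ==> (0 <= wt (take q s))].

(* V_word s implies wt s = -1, so that the generated Lie subalgebra is         *)
(* contained in the span of the words of weight <= 0.                          *)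
Definition gA : word_algebra -> Prop := lie_gen commutator (word_span V_word).

(* For wt s <= 0 the absolute value `|wt s| is - wt s; words of positive weight *)
(* do not occur in gA.                                                         *)
Definition word_tri s r : word_algebra :=
  \sum_(j < size r)
    word (take j r ++ shift `|wt s|%N (tnth (in_tuple r) j) :: s
          ++ drop j.+1 r).

Definition tri_w (x y : word_algebra) : word_algebra :=
  linext (fun s => linext (fun r => word_tri s r) y) x.

End WordSide.
Arguments word_algebra k A : clear implicits.
Arguments gA k A : clear implicits.

Section Fertility.
Context {k : fieldType} {A : finType}.

Fixpoint fertility_word (t : otree A) : seq (@letter A) :=
  let: Node a ts := t in (a, size ts) :: flatten (map fertility_word ts).

Definition Phi_fer : forest_algebra k A -> word_algebra k A :=
  linext (fun F => word (flatten (map fertility_word F))).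

End Fertility.

(* Main.v *)
From HB Require Import structures.
Require Import Defs.
From mathcomp Require Import all_boot all_order all_algebra.
From mathcomp Require Import finmap monalg zify.

Set Implicit Arguments.
Unset Strict Implicit.
Unset Printing Implicit Defensive.
Import GRing.Theory.
Local Open Scope ring_scope.

(** Reading the fertilities of the vertices of a planar tree is the Lukasiewicz
    coding: it maps trees bijectively onto the words that span V(A), and it is a
    prefix code, so that concatenating the codes of the trees of a forest is
    injective as well ([fertility_word_prefix], [forest_decode]).  Hence the
    fertility map is an injective algebra morphism which identifies the
    generators of the two Lie algebras, and therefore a Lie isomorphism.

    It remains to compare the products.  Grafting a tree s as leftmost child of
    a vertex v raises the fertility of v by one and writes the code of s right
    after the letter of v; this is the insertion of the code of s at that
    letter.  Grafting a tree and inserting a word are both derivations of free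
    algebras, determined by their values on generators, so the fertility map
    intertwines them whenever the left operand is a tree.

    To pass from trees to Lie elements, write > for either product.  On the
    tree side the recursion (s F) > y = s > (F > y) - (s > F) > y is the
    definition of the product for a tree s, and by induction on the number of
    brackets it holds with any Lie element x in place of s
    ([lie_gen_associative]).  It gives the rule

      [x, y] > w = x > (y > w) - y > (x > w) - (x > y) > w + (y > x) > w,

    which is the second post-Lie axiom; the first one says that Lie elements act
    by derivations.  The rule also holds for insertion of words of nonpositive
    weight: both sides are derivations in w, and on a letter the rule amounts to
    the additivity of the weight ([tri_w_commutator]).  As the rule determines
    the action of a bracket from actions of lower degree, the same induction
    shows that the fertility map intertwines the products
    ([Phi_fer_left_graft]).  The post-Lie axioms on the word side are then
    images of those on the tree side ([post_lie_image]). *)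

(** * Commutators and Leibniz rules in rings *)

Definition ring_commutator (R : pzRingType) (x y : R) := x * y - y * x.

Lemma ring_commutator_jacobi (R : pzRingType) (x y z : R) :
  let br := @ring_commutator R in
  br x (br y z) + br y (br z x) + br z (br x y) = 0.
Proof.
rewrite /= /ring_commutator !mulrBr !mulrBl !mulrA !opprB.
(* Each of the six products occurs twice, with opposite signs. *)
rewrite !addrA [LHS](ACl ((1*12)*(7*2)*(3*10)*(5*4)*(11*6)*(9*8))) /=.
by rewrite !subrr !addr0.
Qed.

Lemma leibniz_linearr (k : fieldType) (R : lalgType k) (c : k)
    (x y y' dx dy dy' dxy dxy' : R) :
  (forall (a : k) (u v : R), u * (a *: v) = a *: (u * v)) ->
  dxy = dx * y + x * dy -> dxy' = dx * y' + x * dy' ->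
  c *: dxy + dxy' = dx * (c *: y + y') + x * (c *: dy + dy').
Proof. by move=> sAr -> ->; rewrite !mulrDr !sAr scalerDr addrACA. Qed.

Lemma leibniz_linearl (k : fieldType) (R : lalgType k) (c : k)
    (x x' y dx dx' dy dxy dxy' : R) :
  dxy = dx * y + x * dy -> dxy' = dx' * y + x' * dy ->
  c *: dxy + dxy' = (c *: dx + dx') * y + (c *: x + x') * dy.
Proof. by move=> -> ->; rewrite !mulrDl -!scalerAl scalerDr addrACA. Qed.

Lemma leibniz_step (R : pzRingType) (fa a s ds r dr : R) :
  fa * (s * r) + a * (ds * r + s * dr) = (fa * s + a * ds) * r + a * s * dr.
Proof. by rewrite mulrDl mulrDr !mulrA addrA. Qed.

Lemma leibniz_mull (R : pzRingType) (w a b c d : R) :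
  w * a * b + w * c * d = w * (a * b + c * d).
Proof. by rewrite mulrDr !mulrA. Qed.

(** With [phi] the identity these are the derivations; the twisted form
    compares the two ways round a square whose sides are a derivation and an
    algebra morphism [phi]. *)
Definition derivation_along (R S : pzRingType) (phi f : R -> S) :=
  forall x y, f (x * y) = f x * phi y + phi x * f y.

Definition derivation (R : pzRingType) (f : R -> R) := derivation_along id f.

(** * The free associative algebra *)
Section FreeAlgebraTheory.
Context {k : fieldType} {X : choiceType}.
Local Notation FX := {malg k[{fmonom X}]}.
Implicit Types (x y : FX) (s r : seq X).

Lemma linext_widen (W : lmodType k) (f : seq X -> W) (d : {fset {fmonom X}}) x :
  (msupp x `<=` d)%fset -> linext f x = \sum_(m <- d) x@_m *: f m.
Proof.
move=> le; apply: big_fset_incl => // m _ /mcoeff_outdom ->.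
by rewrite scale0r.
Qed.

Lemma linext_is_linear (W : lmodType k) (f : seq X -> W) : linear (linext f).
Proof.
move=> c x y; pose d := (msupp x `|` msupp y)%fset.
have lex : (msupp x `<=` d)%fset by apply: fsubsetUl.
have ley : (msupp y `<=` d)%fset by apply: fsubsetUr.
have lez : (msupp (c *: x + y) `<=` d)%fset.
  apply: fsubset_trans (msuppD_le _ _) _; rewrite fsubUset ley andbT.
  exact: fsubset_trans (msuppZ_le _ _) lex.
rewrite (linext_widen f lex) (linext_widen f ley) (linext_widen f lez).
rewrite scaler_sumr -big_split /=; apply: eq_bigr => m _.
by rewrite mcoeffD mcoeffZ scalerDl scalerA.
Qed.

HB.instance Definition _ (W : lmodType k) (f : seq X -> W) :=
  GRing.isLinear.Build k FX W *:%R (linext f) (linext_is_linear f).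

Lemma word_nil : word [::] = 1 :> FX.
Proof. by rewrite /word -fmoneE. Qed.

Lemma word_cat s r : word (s ++ r) = word s * word r :> FX.
Proof.
by rewrite /word malgM_def fgmulUU mulr1 -[mmul _ _]/(fmmul _ _) fmmulE.
Qed.

Lemma word_cons a s : word (a :: s) = word [:: a] * word s :> FX.
Proof. by rewrite -word_cat. Qed.

Lemma malg_scalerAr (c : k) x y : x * (c *: y) = c *: (x * y).
Proof.
rewrite [in LHS](malgMEw (fsubset_refl _) (msuppZ_le c y)) malgME.
rewrite scaler_sumr; apply: eq_bigr => m _.
rewrite scaler_sumr; apply: eq_bigr => m' _.
by apply/malgP => w; rewrite !(mcoeffZ, mcoeffU) mulrCA mulrnAr.
Qed.

Lemma malg_scalerAl (c : k) x y : (c *: x) * y = c *: (x * y).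
Proof. exact: esym (scalerAl _ _ _). Qed.

Lemma malg_mulPl (c : k) x y z : (c *: x + y) * z = c *: (x * z) + y * z.
Proof. by rewrite mulrDl malg_scalerAl. Qed.

Lemma malg_mulPr (c : k) x y z : z * (c *: x + y) = c *: (z * x) + z * y.
Proof. by rewrite mulrDr malg_scalerAr. Qed.

Lemma word_ind (Q : FX -> Prop) :
  Q 0 -> (forall s, Q (word s)) ->
  (forall c x y, Q x -> Q y -> Q (c *: x + y)) -> forall x, Q x.
Proof.
move=> Q0 QS QL x; apply: (@word_span_ind k X predT) => //.
by move=> c u v _ _; apply: QL.
Qed.

Lemma linear_fun0 (V W : lmodType k) (f : V -> W) : linear f -> f 0 = 0.
Proof.
by move=> fl; rewrite -{1}(addNr 0) -scaleN1r fl scaleN1r addNr.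
Qed.

Lemma linear_ext (W : lmodType k) (f g : FX -> W) : linear f -> linear g ->
  (forall s, f (word s) = g (word s)) -> f =1 g.
Proof.
move=> fl gl fg; apply: word_ind => // [|c x y Ex Ey].
  by rewrite !linear_fun0.
by rewrite fl gl Ex Ey.
Qed.

Lemma subspace_sum (V : lmodType k) (P : V -> Prop) (I : Type) (r : seq I)
    (F : I -> V) :
  subspace P -> (forall i, P (F i)) -> P (\sum_(i <- r) F i).
Proof.
move=> [P0 PL] PF; elim/big_rec: _ => // i x _ Px.
by rewrite -[F i]scale1r; apply: PL.
Qed.

Lemma subspaceB (V : lmodType k) (P : V -> Prop) (u v : V) :
  subspace P -> P u -> P v -> P (u - v).
Proof. by move=> [_ PL] Pu Pv; rewrite addrC -scaleN1r; apply: PL. Qed.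

Lemma word_span_linext (W : lmodType k) (P : W -> Prop) (S : pred (seq X))
    (f : seq X -> W) x :
  subspace P -> (forall s, S s -> P (f s)) -> word_span S x -> P (linext f x).
Proof.
move=> [P0 PL] Pf; move: x.
apply: word_span_ind => [|s Ss|c x y _ _ Px Py]; first by rewrite linear0.
  by rewrite linext_word; apply: Pf.
by rewrite linearP; apply: PL.
Qed.

Lemma eq_linext_in (W : lmodType k) (S : pred (seq X)) (f g : seq X -> W) x :
  (forall s, S s -> f s = g s) -> word_span S x -> linext f x = linext g x.
Proof. by move=> fg Sx; apply: eq_big_seq => m /Sx /fg ->. Qed.

Lemma word_span_mul (S1 S2 S : pred (seq X)) x y :
  (forall s r, S1 s -> S2 r -> S (s ++ r)) ->
  word_span S1 x -> word_span S2 y -> word_span S (x * y).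
Proof.
move=> S12 S1x S2y; have [S0 SL] := @word_span_subspace k X S.
move: x S1x; apply: word_span_ind => [|s S1s|c u v _ _ Su Sv].
- by rewrite mul0r.
- move: y S2y; apply: word_span_ind => [|r S2r|c u v _ _ Su Sv].
  + by rewrite mulr0.
  + by rewrite -word_cat; apply/word_span_word/S12.
  + by rewrite mulrDr malg_scalerAr; apply: SL.
- by rewrite mulrDl malg_scalerAl; apply: SL.
Qed.

(** This form lets linear maps act on commutators through the one rule
    f (c *: x + y) = c *: f x + f y. *)
Lemma commutatorE x y :
  commutator x y = -1 *: (y * x) + x * y.
Proof. by rewrite /commutator scaleN1r addrC. Qed.

Lemma commutator_linearl (c : k) x y z :
  commutator (c *: x + y) z = c *: commutator x z + commutator y z.
Proof.
rewrite /commutator mulrDl mulrDr malg_scalerAr malg_scalerAl.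
by rewrite scalerBr opprD addrACA.
Qed.

Lemma commutator_linearr (c : k) x y z :
  commutator z (c *: x + y) = c *: commutator z x + commutator z y.
Proof.
rewrite /commutator mulrDl mulrDr malg_scalerAr malg_scalerAl.
by rewrite scalerBr opprD addrACA.
Qed.

Lemma commutator_jacobi x y z :
  commutator x (commutator y z) + commutator y (commutator z x)
    + commutator z (commutator x y) = 0.
Proof. exact: ring_commutator_jacobi. Qed.

Lemma lie_gen_subspace (br : FX -> FX -> FX) (S : FX -> Prop) :
  subspace (lie_gen br S).
Proof.
by split=> [|c x y Sx Sy]; [apply: LieGen_zero|apply: LieGen_linear].
Qed.

Lemma commutator_lie (S : FX -> Prop) :
  lie_algebra (lie_gen commutator S) commutator.
Proof.
split; first exact: lie_gen_subspace.
- split=> [x y Sx Sy|c x y z _ _ _|c x y z _ _ _].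
  + exact: LieGen_bracket.
  + exact: commutator_linearl.
  + exact: commutator_linearr.
- by move=> x _; rewrite /commutator subrr.
- by move=> x y z _ _ _; apply: commutator_jacobi.
Qed.

(** Letters generate the algebra, and the Leibniz rule leaves no freedom on
    products; on the empty word it reads f 1 = f 1 + f 1. *)
Lemma derivation_along_ext (R : lalgType k) (phi : FX -> R) (f g : FX -> R) :
  linear f -> linear g -> phi 1 = 1 ->
  derivation_along phi f -> derivation_along phi g ->
  (forall a, f (word [:: a]) = g (word [:: a])) -> f =1 g.
Proof.
move=> fl gl phi1 df dg fg; apply: linear_ext => //; elim=> [|a s IHs].
  have d1 (h : FX -> R) : derivation_along phi h -> h 1 = 0.
    move/(_ 1 1); rewrite !mulr1 phi1 mulr1 mul1r => /eqP.
    by rewrite -subr_eq0 opprD addrA subrr sub0r oppr_eq0 => /eqP.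
  by rewrite word_nil !d1.
by rewrite word_cons df dg fg IHs.
Qed.

(** The derivation of the free algebra with prescribed values on letters.  Its
    formula has the shape of [tree_graft_der], and of [word_tri] once the
    inserted word is split off, so both products are instances of it. *)
Definition derivation_of (f : X -> FX) : FX -> FX :=
  linext (fun s => \sum_(j < size s)
    word (take j s) * f (tnth (in_tuple s) j) * word (drop j.+1 s)).

HB.instance Definition _ f := GRing.Linear.on (derivation_of f).

Lemma derivation_of1 f : derivation_of f 1 = 0.
Proof. by rewrite -word_nil /derivation_of linext_word big_ord0. Qed.

Lemma derivation_of_cons f a s :
  derivation_of f (word (a :: s))
    = f a * word s + word [:: a] * derivation_of f (word s).
Proof.
rewrite /derivation_of !linext_word big_ord_recl /= word_nil mul1r drop0.
congr (_ + _).
rewrite mulr_sumr; apply: eq_bigr => j _.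
by rewrite /= !(tnth_nth a) /= /bump /= add1n /= (word_cons a) !mulrA.
Qed.

Lemma derivation_of_letter f a : derivation_of f (word [:: a]) = f a.
Proof.
by rewrite derivation_of_cons word_nil derivation_of1 mulr1 mulr0 addr0.
Qed.

Lemma derivation_ofP f : derivation (derivation_of f).
Proof.
move=> x y; rewrite /=; move: x; apply: word_ind => [|s|c x x' Ex Ex'].
- by rewrite !mul0r !linear0 mul0r addr0.
- move: y; apply: word_ind => [|r|c y y' Ey Ey'].
  + by rewrite mulr0 !linear0 !mulr0 addr0.
  + elim: s => [|a s IHs].
      by rewrite word_nil derivation_of1 !mul1r mul0r add0r.
    rewrite -word_cat cat_cons 2!derivation_of_cons word_cat IHs.
    rewrite (word_cons a s).
    exact: leibniz_step.
  + rewrite malg_mulPr !(linearP (derivation_of f)) /=.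
    exact: (@leibniz_linearr k FX c _ _ _ _ _ _ _ _ malg_scalerAr Ey Ey').
- rewrite malg_mulPl !(linearP (derivation_of f)) /=.
  exact: (@leibniz_linearl k FX c _ _ _ _ _ _ _ _ Ex Ex').
Qed.

Lemma derivation_of_length f n x :
  (forall a, word_span (fun s => size s == 1%N) (f a)) ->
  word_span (fun s => size s == n) x ->
  word_span (fun s => size s == n) (derivation_of f x).
Proof.
move=> f1; apply: word_span_linext => [|s /eqP <-].
  exact: word_span_subspace.
apply: subspace_sum => [|j]; first exact: word_span_subspace.
pose szP i (r : seq X) := size r == i.
apply: (@word_span_mul (szP j.+1) (szP (size s - j.+1)%N)).
- by move=> r t /eqP r1 /eqP t1; rewrite size_cat r1 t1 subnKC.
- apply: (@word_span_mul (szP j) (szP 1%N)) => //.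
  + by move=> r t /eqP r1 /eqP t1; rewrite /szP size_cat r1 t1 addn1.
  + by apply: word_span_word; rewrite /szP size_takel // ltnW.
- by apply: word_span_word; rewrite /szP size_drop.
Qed.

End FreeAlgebraTheory.

(** * Post-Lie products from the Guin-Oudom recursion *)
Section GuinOudom.
Context {k : fieldType} {R : lalgType k} (S : R -> Prop) (B : R -> R -> R).
Implicit Types (x y z G : R).

Local Notation br := (@ring_commutator R).
Local Notation L := (lie_gen br S).

Hypothesis sAr : forall (c : k) x y, x * (c *: y) = c *: (x * y).
Hypothesis brP : lie_algebra L br.
Hypothesis Bl : forall (c : k) x y z, B (c *: x + y) z = c *: B x z + B y z.
Hypothesis Br : forall (c : k) x y z, B z (c *: x + y) = c *: B z x + B z y.

(** The Guin-Oudom rule, which extends an action of Lie elements to their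
    enveloping algebra. *)
Definition associative_at x G y := B (x * G) y = B x (B G y) - B (B x G) y.

(** The middle argument [G] ranges over the whole algebra, not only over Lie
    elements: the induction on brackets substitutes products for it. *)
Definition associative_action x := forall G y, associative_at x G y.

Hypothesis B_stable : forall x s, S s -> S (B x s).
Hypothesis B_derivation : forall s, S s -> derivation (B s).
Hypothesis B_associative : forall s, S s -> associative_action s.

Lemma actBl x y z : B (x - y) z = B x z - B y z.
Proof. by rewrite addrC -scaleN1r Bl scaleN1r addrC. Qed.

Lemma actBr x y z : B z (x - y) = B z x - B z y.
Proof. by rewrite addrC -scaleN1r Br scaleN1r addrC. Qed.

Lemma actDr x y z : B z (x + y) = B z x + B z y.
Proof. by rewrite -[x in LHS]scale1r Br scale1r. Qed.

Lemma actDl x y z : B (x + y) z = B x z + B y z.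
Proof. by rewrite -[x in LHS]scale1r Bl scale1r. Qed.

Lemma act0l z : B 0 z = 0.
Proof. by rewrite -{1}(subrr 0) actBl subrr. Qed.

Lemma act0r z : B z 0 = 0.
Proof. by rewrite -{1}(subrr 0) actBr subrr. Qed.

Lemma act_commutatorr x y z : derivation (B x) ->
  B x (br y z) = br (B x y) z + br y (B x z).
Proof.
move=> dx; rewrite /ring_commutator actBr !dx /=.
by rewrite opprD [- _ - _ in LHS]addrC addrACA.
Qed.

Lemma homogeneous_act n x y : derivation (B x) ->
  homogeneous br S n y -> homogeneous br S n (B x y).
Proof.
move=> dx; elim=> {n y} [y Sy|n n0|n c y z _ Hy _ Hz|m n y z Hy Hxy Hz Hxz].
- exact/Hom_mem/B_stable.
- by rewrite act0r; apply: Hom_zero.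
- by rewrite Br; apply: Hom_linear.
- rewrite act_commutatorr // -[br (B x y) z]scale1r.
  by apply: Hom_linear; apply: Hom_bracket.
Qed.

Lemma lie_gen_act x y : derivation (B x) -> L y -> L (B x y).
Proof.
move=> dx; elim=> {y} [y Sy||c y z _ Hy _ Hz|y z Ly Lxy Lz Lxz].
- exact/LieGen_mem/B_stable.
- by rewrite act0r; apply: LieGen_zero.
- by rewrite Br; apply: LieGen_linear.
- rewrite act_commutatorr // -[br (B x y) z]scale1r.
  by apply: LieGen_linear; apply: LieGen_bracket.
Qed.

(** If x and y have bracket degrees m and n, then B x y has the degree of y and
    B y x that of x, because derivations stabilising the generators preserve
    the degree.  Both degrees are less than m + n, so in an induction on the
    degree the elements B x y and B y x are available when [x, y] is treated. *)
Lemma lie_gen_act_ind (Q : R -> Prop) :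
  (forall x, Q x -> derivation (B x)) ->
  Q 0 -> (forall c x y, L x -> L y -> Q x -> Q y -> Q (c *: x + y)) ->
  (forall s, S s -> Q s) ->
  (forall x y, L x -> L y -> Q x -> Q y -> Q (B x y) -> Q (B y x) ->
     Q (br x y)) ->
  forall x, L x -> Q x.
Proof.
move=> Qd Q0 QL QS Qbr; apply: (lie_gen_homogeneous_ind brP) => // n x Hx.
have [N] := ubnP n; elim: N n x Hx => // N IHN n x; rewrite ltnS.
elim=> {n x} [x Sx _|n _ _|n c x y Hx IHx Hy IHy len|m n x y Hx _ Hy _ le].
- exact: QS.
- exact: Q0.
- have [Lx Ly] := (homogeneous_lie_gen Hx, homogeneous_lie_gen Hy).
  by apply: QL => //; [apply: IHx|apply: IHy].
- have [m0 n0] := (homogeneous_gt0 Hx, homogeneous_gt0 Hy).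
  have ltm : (m < N)%N by lia.
  have ltn : (n < N)%N by lia.
  have [Qx Qy] := (IHN _ _ Hx ltm, IHN _ _ Hy ltn).
  apply: Qbr => //; try exact: homogeneous_lie_gen Hx.
  + exact: homogeneous_lie_gen Hy.
  + by apply: (IHN _ _ _ ltn); apply: homogeneous_act => //; apply: Qd.
  + by apply: (IHN _ _ _ ltm); apply: homogeneous_act => //; apply: Qd.
Qed.

(** The action of [x, y] that the second post-Lie axiom prescribes. *)
Definition bracket_action x y w :=
  (B x (B y w) - B y (B x w)) - (B (B x y) w - B (B y x) w).

Lemma act_commutatorl x y w : associative_at x y w -> associative_at y x w ->
  B (br x y) w = bracket_action x y w.
Proof.
move=> ax ay; rewrite /ring_commutator actBl ax ay /bracket_action.
by rewrite !opprD !opprK addrACA.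
Qed.

Lemma bracket_action_is_linear x y : linear (bracket_action x y).
Proof.
move=> c u v; rewrite /bracket_action !Br !scalerBr !opprD !addrA.
by rewrite !opprK [LHS](ACl (1*3*5*7*2*4*6*8)).
Qed.

(** The mixed terms f x * g y and g x * f y occur in both compositions, and
    cancel. *)
Lemma derivation_bracket (f g : R -> R) :
  {morph f : x y / x + y} -> {morph g : x y / x + y} ->
  derivation f -> derivation g -> derivation (fun x => f (g x) - g (f x)).
Proof.
move=> fD gD df dg x y; rewrite /= df dg fD gD !df !dg /=.
rewrite mulrBl mulrBr !opprD !addrA.
by rewrite [LHS](ACl ((1*5)*(4*8)*(2*7)*(3*6))) /= !subrr !addr0 addrA.
Qed.

Lemma derivationB (f g : R -> R) :
  derivation f -> derivation g -> derivation (fun x => f x - g x).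
Proof.
move=> df dg x y; rewrite /= df dg /= mulrBl mulrBr opprD.
by rewrite addrACA.
Qed.

Lemma bracket_action_derivation x y :
  derivation (B x) -> derivation (B y) ->
  derivation (B (B x y)) -> derivation (B (B y x)) ->
  derivation (bracket_action x y).
Proof.
move=> dx dy dxy dyx; apply: derivationB; last exact: derivationB.
apply: derivation_bracket => // u v; exact: actDr.
Qed.

(** Expanding (x (y G)) > w by the rule for x, then for y and for x > y, leaves
    no product of Lie elements; the right-hand side is ready to be
    antisymmetrised in x and y. *)
Lemma act_mul_mul x y G w :
  derivation (B x) -> associative_action x -> associative_action y ->
  associative_action (B x y) ->
  B (x * (y * G)) w =
    B x (B y (B G w)) - B x (B (B y G) w)
    - (B (B x y) (B G w) - B (B (B x y) G) w)
    - (B y (B (B x G) w) - B (B y (B x G)) w).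
Proof.
move=> dx ax ay axy; rewrite ax ay actBr dx /= actDl axy ay.
by rewrite opprD addrA.
Qed.

Lemma derivation_subspace : subspace (fun x => derivation (B x)).
Proof.
split=> [x y|c x y dx dy u v]; first by rewrite !act0l mul0r mulr0 addr0.
by rewrite !Bl dx dy !mulrDl !mulrDr sAr -!scalerAl scalerDr addrACA.
Qed.

Lemma associative_at_subspacel G y : subspace (fun x => associative_at x G y).
Proof.
split=> [|c x z ax az]; first by rewrite /associative_at mul0r !act0l subr0.
rewrite /associative_at mulrDl -scalerAl !Bl ax az scalerBr opprD.
by rewrite addrACA.
Qed.

Lemma associative_at_subspacer x y : subspace (fun G => associative_at x G y).
Proof.
split=> [|c G H aG aH].
  by rewrite /associative_at mulr0 act0r !act0l act0r subr0.
rewrite /associative_at mulrDr sAr Br !Bl aG aH Br scalerBr opprD.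
by rewrite addrACA.
Qed.

Lemma associative_subspace : subspace associative_action.
Proof.
split=> [|c x y ax ay] G w; have [a0 aL] := associative_at_subspacel G w.
  exact: a0.
exact: aL.
Qed.

(** The two properties have to be carried together: to expand ([x, y] G) > w one
    moves x across the product y G, which uses that x acts as a derivation, and
    [x, y] acts as a derivation because the rule expresses its action by
    commutators of derivations. *)
Lemma lie_gen_associative x : L x -> derivation (B x) /\ associative_action x.
Proof.
have [[d0 dL] [a0 aL]] := (derivation_subspace, associative_subspace).
move: x; apply: lie_gen_act_ind => [x []//||c x y _ _ [dx ax] [dy ay]|s Ss|] //.
- by split; [apply: dL|apply: aL].
- by split; [apply: B_derivation|apply: B_associative].
move=> x y _ _ [dx ax] [dy ay] [dxy axy] [dyx ayx].
have Bbr w : B (br x y) w = bracket_action x y w by exact: act_commutatorl.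
split.
- by move=> u v; rewrite !Bbr; apply: bracket_action_derivation.
- move=> G w; rewrite /associative_at {1}/ring_commutator mulrBl -!mulrA actBl.
  rewrite !act_mul_mul // !Bbr /bracket_action !actBl.
  rewrite !opprB !addrA.
  (* The terms x > ((y > G) > w) and y > ((x > G) > w) cancel in pairs. *)
  rewrite [LHS](ACl ((2*7)*(6*11)*1*12*9*4*3*10*5*8)) /=.
  by rewrite !addNr !add0r.
Qed.

Lemma guin_oudom_post_lie : post_lie_algebra L B br.
Proof.
have good := lie_gen_associative.
split=> //.
- split=> // x y Lx Ly; apply: lie_gen_act => //; exact: (good x Lx).1.
- by move=> x y z Lx _ _; apply: act_commutatorr; apply: (good x Lx).1.
- move=> x y z Lx Ly _; rewrite act_commutatorl.
  + by rewrite /associator /bracket_action !opprD !opprK addrACA.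
  + by apply: (good x Lx).2.
  + by apply: (good y Ly).2.
Qed.
End GuinOudom.

(** A linear map intertwining the actions of x, y, B x y and B y x also
    intertwines that of [x, y], since only these enter [bracket_action]. *)
Lemma bracket_action_morphism (k : fieldType) (R S : lalgType k)
    (B : R -> R -> R) (T : S -> S -> S) (f : R -> S) x y w :
  linear f ->
  (forall z, f (B x z) = T (f x) (f z)) ->
  (forall z, f (B y z) = T (f y) (f z)) ->
  (forall z, f (B (B x y) z) = T (f (B x y)) (f z)) ->
  (forall z, f (B (B y x) z) = T (f (B y x)) (f z)) ->
  f (bracket_action B x y w) = bracket_action T (f x) (f y) (f w).
Proof.
move=> fl fx fy fxy fyx.
have fB u v : f (u - v) = f u - f v.
  by rewrite addrC -scaleN1r fl scaleN1r addrC.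
by rewrite /bracket_action !fB fxy fyx !fx !fy !fx.
Qed.

(** * Fertility words are Lukasiewicz words *)
Section Lukasiewicz.
Context {A : finType}.
Implicit Types (t : otree A) (F G ts : seq (otree A)) (r s : seq (@letter A)).

(** Induction with a hypothesis for every child, which the induction principle
    generated for this nested type does not give. *)
Fixpoint otree_ind_in (P : otree A -> Prop)
    (H : forall a ts, (forall t, t \in ts -> P t) -> P (Node a ts)) t : P t.
Proof.
case: t => a ts; apply: (H); elim: ts => [//|u us IH] t.
rewrite inE => /predU1P[->|]; last exact: IH.
exact: (otree_ind_in P H).
Qed.

Definition forest_word F : seq (@letter A) := flatten (map fertility_word F).

Lemma forest_word_cat F G :
  forest_word (F ++ G) = forest_word F ++ forest_word G.
Proof. by rewrite /forest_word map_cat flatten_cat. Qed.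

Lemma forest_word_cons t F :
  forest_word (t :: F) = fertility_word t ++ forest_word F.
Proof. by []. Qed.

(** Deleting the first letter of a forest word replaces the first tree by its
    children; weights, suffixes and decodings are computed by this step. *)
Lemma forest_word_node a ts F : forest_word (Node a ts :: F)
  = (a, size ts) :: forest_word (ts ++ F).
Proof. by rewrite forest_word_cat. Qed.

(** Fertility words form a prefix code: the first letter tells how many words of
    subtrees have to be read next. *)
Lemma fertility_word_prefix t u r s :
  fertility_word t ++ r = fertility_word u ++ s -> t = u /\ r = s.
Proof.
elim/otree_ind_in: t u r s => a ts IH [b us] r s [-> sz E].
suff [-> ->] : ts = us /\ r = s by [].
elim: ts us sz IH E => [|t ts IHts] [|u us] //= [sz] IH.
rewrite -!catA => /(IH t (mem_head _ _)) [-> E].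
have [v vts|-> ->] := IHts us sz _ E; last by [].
by apply: IH; rewrite inE vts orbT.
Qed.

Lemma forest_word_inj : injective forest_word.
Proof.
elim=> [|t F IH] [|u G] //.
- by case: u.
- by case: t.
- by rewrite !forest_word_cons => /fertility_word_prefix [-> /IH ->].
Qed.

Lemma wt_nil : wt ([::] : seq (@letter A)) = 0.
Proof. by rewrite /wt big_nil. Qed.

Lemma wt_cons (z : @letter A) s : wt (z :: s) = z.2%:Z - 1 + wt s.
Proof. by rewrite /wt big_cons. Qed.

Lemma wt_cat r s : wt (r ++ s) = wt r + wt s.
Proof. by rewrite /wt big_cat. Qed.

Lemma wt_forest_word F : wt (forest_word F) = - (size F)%:Z.
Proof.
have [n] := ubnP (size (forest_word F)); elim: n F => // n IHn [|[a ts] F].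
  by rewrite /forest_word wt_nil.
rewrite forest_word_node ltnS wt_cons => /IHn ->.
by rewrite size_cat /=; lia.
Qed.

Lemma drop_forest_word q F : exists G, drop q (forest_word F) = forest_word G.
Proof.
elim: q F => [|q IHq] [|[a ts] F]; try by exists [::].
- by exists (Node a ts :: F); rewrite drop0.
- by rewrite forest_word_node; apply: IHq.
Qed.

(** A nonempty suffix of a tree word is the word of a nonempty forest, of weight
    -1 or less, and the whole word has weight -1; hence proper prefixes have
    nonnegative weight. *)
Lemma V_word_fertility t : V_word (fertility_word t).
Proof.
have -> : fertility_word t = forest_word [:: t].
  by rewrite /forest_word /= cats0.
apply/andP; split; first by rewrite wt_forest_word.
apply/forallP => q; apply/implyP => _.
set s := forest_word _ in q *; have [G EG] := drop_forest_word q [:: t].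
have := wt_cat (take q s) (drop q s).
rewrite cat_take_drop EG !wt_forest_word.
case: G EG => [|u G] /= EG; last by lia.
by have := ltn_ord q; rewrite -subn_gt0 -size_drop EG.
Qed.

(** Lukasiewicz decoding.  The natural number m counts the trees still to be
    read; reading a letter of fertility f turns m into m - 1 + f, and the
    positivity condition says that it only vanishes at the end of the word. *)
Lemma forest_decode r m : wt r = - m%:Z ->
  (forall q, (q < size r)%N -> 0 < m%:Z + wt (take q r)) ->
  exists2 F, size F = m & forest_word F = r.
Proof.
elim: r m => [|[a f] r IHr] m.
  by rewrite wt_nil => m0 _; exists [::] => //=; lia.
rewrite wt_cons /= => Ewt pos.
have m0 : (0 < m)%N by have := pos 0 isT; rewrite take0 wt_nil; lia.
have [|q ltq|F sF EF] := IHr (m.-1 + f)%N; first by lia.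
  by have := pos q.+1 ltq; rewrite /= wt_cons /=; lia.
(* The first f trees of F are the children of the vertex just read. *)
exists (Node a (take f F) :: drop f F); first by rewrite /= size_drop; lia.
by rewrite forest_word_node cat_take_drop EF size_takel //; lia.
Qed.

Lemma V_word_decode r : V_word r -> exists t, fertility_word t = r.
Proof.
case/andP=> /eqP wr /forallP pre.
have [q|[|t []] // _ <-] := @forest_decode r 1 wr.
  case: q => [|q] ltq; first by rewrite take0 wt_nil.
  by have := pre (Ordinal ltq); rewrite implyTb /=; lia.
by exists t; rewrite /forest_word /= cats0.
Qed.

End Lukasiewicz.

(** * Left grafting of forests *)
Section TreeSideTheory.
Context {k : fieldType} {A : finType}.
Local Notation FA := (forest_algebra k A).
Implicit Types (s t : otree A) (F G : seq (otree A)) (x y : FA).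
Local Notation single := (@word_span k (otree A) (fun F => size F == 1%N)).

Lemma singleton_seq (T : Type) (r : seq T) :
  size r = 1%N -> exists a, r = [:: a].
Proof. by case: r => [|a []] // _; exists a. Qed.

Lemma tree_graft_derE s : @tree_graft_der k A s = derivation_of (tree_graft s).
Proof. by []. Qed.

Lemma tree_graft_single s t : single (tree_graft s t).
Proof.
apply: subspace_sum => [|v]; first exact: word_span_subspace.
exact: word_span_word.
Qed.

Lemma forest_graft_is_linear n F : linear (@forest_graft k A n F).
Proof.
elim: n F => [|n IHn] [|s F] c x y //=; first by rewrite scaler0 addr0.
rewrite IHn tree_graft_derE (linearP (derivation_of (tree_graft s))) /=.
set u := derivation_of _ (word F).
have -> : linext (fun G => forest_graft n G (c *: x + y)) u
    = c *: linext (fun G => forest_graft n G x) u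
      + linext (fun G => forest_graft n G y) u.
  rewrite /linext scaler_sumr -big_split; apply: eq_bigr => m _ /=.
  by rewrite IHn scalerDr !scalerA mulrC.
by rewrite scalerBr opprD addrACA.
Qed.

Lemma left_graft_linearr (c : k) x y z :
  left_graft z (c *: x + y) = c *: left_graft z x + left_graft z y.
Proof.
rewrite /left_graft /linext scaler_sumr -big_split; apply: eq_bigr => m _ /=.
by rewrite forest_graft_is_linear scalerDr !scalerA mulrC.
Qed.

Lemma left_graft_linearl (c : k) x y z :
  left_graft (c *: x + y) z = c *: left_graft x z + left_graft y z.
Proof. exact: linext_is_linear. Qed.

Lemma left_graft_word F y : left_graft (word F) y = forest_graft (size F) F y.
Proof. exact: linext_word. Qed.

Lemma left_graft_nil y : left_graft (word [::]) y = y.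
Proof. by rewrite /left_graft linext_word. Qed.

(** The defining recursion, freed from its fuel: grafting preserves the number
    of trees, so every forest in D_s F has the size for which the recursive call
    was made. *)
Lemma left_graft_cons s F y : left_graft (word (s :: F)) y
  = derivation_of (tree_graft s) (left_graft (word F) y)
    - left_graft (derivation_of (tree_graft s) (word F)) y.
Proof.
rewrite (left_graft_word (s :: F)) (left_graft_word F y) /=.
suff <- : linext (fun G => forest_graft (size F) G y)
    (derivation_of (tree_graft s) (word F))
    = left_graft (derivation_of (tree_graft s) (word F)) y by [].
apply: (@eq_linext_in _ _ _ (fun G => size G == size F)) => [G /eqP -> //|].
apply: derivation_of_length => [t|]; first exact: tree_graft_single.
exact: word_span_word.
Qed.

Lemma left_graft_letter s y :
  left_graft (word [:: s]) y = derivation_of (tree_graft s) y.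
Proof.
rewrite left_graft_cons left_graft_nil word_nil derivation_of1.
by rewrite /left_graft linear0 subr0.
Qed.

Lemma left_graft_size n x y : word_span (fun F => size F == n) y ->
  word_span (fun F => size F == n) (left_graft x y).
Proof.
have sub := @word_span_subspace k (otree A) (fun F => size F == n).
have szP m F z : word_span (fun F => size F == n) z ->
    word_span (fun F => size F == n) (@forest_graft k A m F z).
  elim: m F z => [|m IHm] [|s F] z nz //=; first by case: sub.
  apply: (subspaceB sub).
    apply: derivation_of_length => [t|]; last exact: IHm.
    exact: tree_graft_single.
  by apply: (@word_span_linext _ _ _ _ predT) => // G _; apply: IHm.
by move=> ny; apply: (@word_span_linext _ _ _ _ predT) => // F _; apply: szP.
Qed.

(** Both properties are linear in x, and for a tree they are the definition of
    the product. *)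
Lemma left_graft_single x : single x ->
  derivation (left_graft x) /\ associative_action (@left_graft k A) x.
Proof.
have [d0 dL] := derivation_subspace (@malg_scalerAr k _) left_graft_linearl.
have [a0 aL] := associative_subspace left_graft_linearl.
move: x; apply: word_span_ind.
- by split; [apply: d0|apply: a0].
2: move=> c y z _ _ [dy ay] [dz az].
2: by split; [exact: (dL c y z dy dz)|exact: (aL c y z ay az)].
move=> _ /eqP/singleton_seq [s ->].
split=> [x y|G y].
  by rewrite !left_graft_letter; apply: derivation_ofP.
have [b0 bL] := associative_at_subspacer (@malg_scalerAr k _)
  left_graft_linearl left_graft_linearr (word [:: s]) y.
move: G; apply: word_ind => [|F|c G G' aG aG'].
- exact: b0.
- rewrite /associative_at (left_graft_letter s (left_graft (word F) y)).
  by rewrite (left_graft_letter s (word F)) -word_cons; apply: left_graft_cons.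
- exact: (bL c G G' aG aG').
Qed.

Lemma left_graft_PSL x : PSL k A x ->
  derivation (left_graft x) /\ associative_action (@left_graft k A) x.
Proof.
apply: lie_gen_associative.
- exact: malg_scalerAr.
- exact: commutator_lie.
- exact: left_graft_linearl.
- exact: left_graft_linearr.
- by move=> y s; apply: left_graft_size.
- by move=> s /left_graft_single [].
- by move=> s /left_graft_single [].
Qed.

Lemma PSL_post_lie :
  post_lie_algebra (PSL k A) (@left_graft k A) (@commutator k _).
Proof.
apply: guin_oudom_post_lie.
- exact: malg_scalerAr.
- exact: commutator_lie.
- exact: left_graft_linearl.
- exact: left_graft_linearr.
- by move=> y s; apply: left_graft_size.
- by move=> s /left_graft_single [].
- by move=> s /left_graft_single [].
Qed.

End TreeSideTheory.

(** * Insertion of words *)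
Section WordSideTheory.
Context {k : fieldType} {A : finType}.
Local Notation WA := (word_algebra k A).
Implicit Types (z : @letter A) (r s : seq (@letter A)) (u v w : WA).

Lemma tri_w_linearl (c : k) u v w :
  tri_w (c *: u + v) w = c *: tri_w u w + tri_w v w.
Proof. exact: linext_is_linear. Qed.

Lemma tri_w_is_linear u : linear (@tri_w k A u).
Proof.
move=> c v w; rewrite /tri_w {1 3 5}/linext scaler_sumr -big_split.
apply: eq_bigr => m _ /=.
by rewrite linext_is_linear scalerDr !scalerA mulrC.
Qed.

HB.instance Definition _ u :=
  GRing.isLinear.Build k WA WA *:%R (tri_w u) (tri_w_is_linear u).

Lemma tri_w_linearr (c : k) u v w :
  tri_w w (c *: u + v) = c *: tri_w w u + tri_w w v.
Proof. exact: tri_w_is_linear. Qed.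

Definition word_insertion s z : WA := word (shift `|wt s| z :: s).

Lemma tri_w_word s w : tri_w (word s) w = derivation_of (word_insertion s) w.
Proof.
rewrite /tri_w linext_word; apply: eq_big_seq => m _; congr (_ *: _).
apply: eq_bigr => j _; rewrite /word_insertion -!word_cat -catA.
by [].
Qed.

Lemma tri_w_derivation u : derivation (tri_w u).
Proof.
have [d0 dL] := derivation_subspace (@malg_scalerAr k _) tri_w_linearl.
move: u; apply: word_ind => [|s|]; [exact: d0| |exact: dL].
by move=> v w; rewrite !tri_w_word; apply: derivation_ofP.
Qed.

Lemma tri_w_word_letter s z :
  tri_w (word s) (word [:: z]) = word [:: shift `|wt s| z] * word s :> WA.
Proof.
by rewrite tri_w_word derivation_of_letter /word_insertion word_cons.
Qed.

(** The shift of the letter depends on u only through its weight, so it factors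
    out when u is homogeneous. *)
Lemma tri_w_homogeneous_letter n u z : word_span (fun s => wt s == n) u ->
  tri_w u (word [:: z]) = word [:: shift `|n| z] * u.
Proof.
move: u; apply: word_span_ind => [|s /eqP <-|c u v _ _ Eu Ev].
- by rewrite mulr0 (act0l tri_w_linearl).
- exact: tri_w_word_letter.
- by rewrite tri_w_linearl malg_mulPr Eu Ev.
Qed.

(** The shift by the absolute value of the weight of s compensates the weight of
    the inserted word s. *)
Lemma tri_w_word_wt s r : wt s <= 0 ->
  word_span (fun q => wt q == wt r) (tri_w (word s) (word r) : WA).
Proof.
move=> s0; rewrite /tri_w !linext_word.
apply: subspace_sum => [|j]; first exact: word_span_subspace.
apply: word_span_word; rewrite wt_cat wt_cons wt_cat.
pose z0 := tnth (in_tuple r) j; have := wt_cat (take j r) (drop j r).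
rewrite cat_take_drop (drop_nth z0) // (tnth_nth z0) wt_cons => ->.
by rewrite /=; lia.
Qed.

Local Notation nonpositive := (@word_span k (@letter A) (fun s => wt s <= 0)).

(** After v has been inserted at z, inserting u either hits a letter of v, which
    gives (u > v) > z, or the shifted letter z, which gives the insertion of u v
    at z: for weights of the same sign the two successive shifts of z add up to
    the shift for u v. *)
Lemma tri_w_associative_letter u v z : nonpositive u -> nonpositive v ->
  associative_at (@tri_w k A) u v (word [:: z]).
Proof.
move=> nu nv; move: u nu; apply: word_span_ind => [|s s0|c u u' _ _].
- by have [] := associative_at_subspacel tri_w_linearl v (word [:: z]).
- move: v nv; have [b0 bL] := associative_at_subspacer (@malg_scalerAr k _)
    tri_w_linearl tri_w_linearr (word s) (word [:: z]).
  apply: word_span_ind => [|r r0|c v v' _ _]; [exact: b0| |exact: bL].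
  rewrite /associative_at (tri_w_homogeneous_letter z (@tri_w_word_wt s r s0)).
  rewrite (tri_w_word_letter r) tri_w_derivation /= addrK tri_w_word_letter.
  rewrite -mulrA -!word_cat tri_w_word_letter -word_cat.
  congr (word (_ :: _)).
  by rewrite /shift /= wt_cat; congr (_, _); lia.
- have [_ bL] := associative_at_subspacel tri_w_linearl v (word [:: z]).
  exact: bL.
Qed.

(** The rule of [associative_at] fails for [tri_w] on longer words, where u and
    v may be inserted at two different letters.  These terms are symmetric in u
    and v: after antisymmetrisation both sides are derivations, and it suffices
    to compare them on letters. *)
Lemma tri_w_commutator u v w : nonpositive u -> nonpositive v ->
  tri_w (commutator u v) w = bracket_action (@tri_w k A) u v w.
Proof.
move=> nu nv; move: w.
apply: (@derivation_along_ext _ _ WA id).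
- exact: tri_w_is_linear.
- by apply: bracket_action_is_linear; exact: tri_w_linearr.
- by [].
- exact: tri_w_derivation.
- by apply: (bracket_action_derivation tri_w_linearr); exact: tri_w_derivation.
- move=> z; apply: (act_commutatorl tri_w_linearl).
    exact: tri_w_associative_letter.
  exact: tri_w_associative_letter.
Qed.

End WordSideTheory.

(** * Transport of post-Lie structures *)
Section PostLieImage.
Context {k : fieldType} {V W : lmodType k}.
Variables (P : V -> Prop) (triP brP : V -> V -> V).
Variables (Q : W -> Prop) (triQ brQ : W -> W -> W) (f : V -> W).

(** Every element of Q is an image, so each axiom on Q is the image of the same
    axiom on P. *)
Lemma post_lie_image : post_lie_algebra P triP brP -> linear f ->
  (forall x, P x -> Q (f x)) ->
  (forall u, Q u -> exists2 x, P x & f x = u) ->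
  (forall x y, P x -> P y -> f (brP x y) = brQ (f x) (f y)) ->
  (forall x y, P x -> P y -> f (triP x y) = triQ (f x) (f y)) ->
  post_lie_algebra Q triQ brQ.
Proof.
move=> [[[P0 PL] brB alt jac] triB der assoc] fl fQ Qf fbr ftri.
have f0 := linear_fun0 fl.
have fD u v : f (u + v) = f u + f v by rewrite -[u in LHS]scale1r fl scale1r.
have fB u v : f (u - v) = f u - f v.
  by rewrite addrC -scaleN1r fl scaleN1r addrC.
have bilinear_image op op' : bilinear_on P op ->
    (forall x y, P x -> P y -> f (op x y) = op' (f x) (f y)) ->
    bilinear_on Q op'.
  move=> [opP opl opr] fop; split.
  - move=> _ _ /Qf [x Px <-] /Qf [y Py <-].
    by rewrite -fop //; apply/fQ/opP.
  - move=> c _ _ _ /Qf [x Px <-] /Qf [y Py <-] /Qf [z Pz <-].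
    by rewrite -fl -!fop ?opl ?fl //; apply: PL.
  - move=> c _ _ _ /Qf [x Px <-] /Qf [y Py <-] /Qf [z Pz <-].
    by rewrite -fl -!fop ?opr ?fl //; apply: PL.
have [[brC _ _] [triC _ _]] := (brB, triB).
split; first split.
- split; first by rewrite -f0; apply: fQ.
  move=> c _ _ /Qf [x Px <-] /Qf [y Py <-].
  by rewrite -fl; apply/fQ/PL.
- exact: bilinear_image fbr.
- by move=> _ /Qf [x Px <-]; rewrite -fbr // alt.
- move=> _ _ _ /Qf [x Px <-] /Qf [y Py <-] /Qf [z Pz <-].
  by rewrite -!(fbr, fD) ?jac //; apply: brC.
- exact: bilinear_image ftri.
- move=> _ _ _ /Qf [x Px <-] /Qf [y Py <-] /Qf [z Pz <-].
  by rewrite -!(fbr, ftri) ?der ?fD //; do ?[exact: brC|exact: triC].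
- move=> _ _ _ /Qf [x Px <-] /Qf [y Py <-] /Qf [z Pz <-].
  rewrite /associator -!(fbr, ftri) ?assoc ?fB //;
    do ?[exact: brC|exact: triC].
Qed.

End PostLieImage.

(** * The fertility map *)
Section FertilityTheory.
Context {k : fieldType} {A : finType}.
Local Notation FA := (forest_algebra k A).
Local Notation WA := (word_algebra k A).
Local Notation Phi := (@Phi_fer k A).
Implicit Types (s t : otree A) (F G ts : seq (otree A)) (x y : FA).

Lemma Phi_fer_is_linear : linear Phi.
Proof. exact: linext_is_linear. Qed.

HB.instance Definition _ :=
  GRing.isLinear.Build k FA WA *:%R (@Phi_fer k A) Phi_fer_is_linear.

Lemma Phi_fer_word F : Phi (word F) = word (forest_word F).
Proof. exact: linext_word. Qed.

Lemma Phi_fer_tree t : Phi (word [:: t]) = word (fertility_word t).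
Proof. by rewrite Phi_fer_word /forest_word /= cats0. Qed.

Lemma Phi_ferM x y : Phi (x * y) = Phi x * Phi y.
Proof.
have linl z : linear (fun u => Phi (u * z)) /\ linear (fun u => Phi u * Phi z).
  split=> c u v; first by rewrite malg_mulPl Phi_fer_is_linear.
  by rewrite Phi_fer_is_linear malg_mulPl.
have linr z : linear (fun u => Phi (z * u)) /\ linear (fun u => Phi z * Phi u).
  split=> c u v; first by rewrite malg_mulPr Phi_fer_is_linear.
  by rewrite Phi_fer_is_linear malg_mulPr.
apply: (linear_ext (linl y).1 (linl y).2) => F.
apply: (linear_ext (linr (word F)).1 (linr (word F)).2) => G.
by rewrite -word_cat !Phi_fer_word forest_word_cat word_cat.
Qed.

Lemma Phi_fer1 : Phi 1 = 1.
Proof. by rewrite -!word_nil Phi_fer_word. Qed.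

Lemma Phi_fer_commutator x y :
  Phi (commutator x y) = commutator (Phi x) (Phi y).
Proof.
rewrite !commutatorE Phi_fer_is_linear.
exact: (f_equal2 (fun u v => -1 *: u + v) (Phi_ferM y x) (Phi_ferM x y)).
Qed.

(** Distinct forests have distinct words, so no coefficients are collected. *)
Lemma mcoeff_Phi_fer x F :
  (Phi x)@_(FMonom (forest_word F)) = x@_(FMonom F).
Proof.
have lin1 : linear (fun x => (Phi x)@_(FMonom (forest_word F)) : k^o).
  by move=> c u v; rewrite Phi_fer_is_linear mcoeffD mcoeffZ.
have lin2 : linear (fun x : FA => x@_(FMonom F) : k^o).
  by move=> c u v; rewrite mcoeffD mcoeffZ.
apply: (linear_ext lin1 lin2) => G.
rewrite Phi_fer_word /word !mcoeffU1; congr (nat_of_bool _)%:R.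
by apply/eqP/eqP => [[/forest_word_inj ->]|[->]].
Qed.

Lemma Phi_fer_inj : injective Phi.
Proof.
by move=> x y E; apply/malgP => [[F]]; rewrite -!mcoeff_Phi_fer E.
Qed.

Lemma Phi_fer_nonpositive x : word_span (fun r => wt r <= 0) (Phi x).
Proof.
apply: (@word_span_linext _ _ _ _ predT) => // [|F _].
  exact: word_span_subspace.
by apply: word_span_word; rewrite wt_forest_word; lia.
Qed.

Local Notation T s := (@tri_w k A (word (fertility_word s))).

(** A fertility word has weight -1: the letter at which it is inserted is
    shifted by 1, as the fertility of a vertex that receives a new child. *)
Lemma tri_w_tree_cons s (z : letter) r : T s (word (z :: r))
  = word (shift 1 z :: fertility_word s ++ r) + word [:: z] * T s (word r).
Proof.
have ws : wt (fertility_word s) = -1.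
  by have /andP[/eqP] := V_word_fertility s.
rewrite !tri_w_word derivation_of_cons; congr (_ + _).
by rewrite /word_insertion ws -word_cat.
Qed.

(** Grafting in the subtrees of a root with children [pre ++ ts], restricted to
    the subtrees [ts]; the prefix [pre] makes the induction on [ts] possible, as
    vertices are addressed by the positions of the children. *)
Lemma tri_w_children s a pre ts :
  (forall t, t \in ts -> \sum_(v <- vertices t)
     word (fertility_word (graft_at s v t)) = T s (word (fertility_word t))) ->
  \sum_(iv <- zip (iota (size pre) (size ts)) (map vertices ts))
     \sum_(v <- iv.2)
       word (fertility_word (graft_at s (iv.1 :: v) (Node a (pre ++ ts))))
  = word ((a, (size pre + size ts)%N) :: forest_word pre)
    * T s (word (forest_word ts)).
Proof.
elim: ts pre => [|t ts IHts] pre IH.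
  by rewrite big_nil tri_w_word word_nil derivation_of1 mulr0.
rewrite big_cons /=.
pose w := word ((a, (size pre + (size ts).+1)%N) :: forest_word pre) : WA.
have -> : \sum_(v <- vertices t) word (fertility_word
    (if drop (size pre) (pre ++ t :: ts) is u :: us then
       Node a (take (size pre) (pre ++ t :: ts) ++ graft_at s v u :: us)
     else Node a (pre ++ t :: ts)))
  = w * T s (word (fertility_word t)) * word (forest_word ts).
  rewrite -IH ?mem_head // mulr_sumr mulr_suml; apply: eq_bigr => v _.
  rewrite drop_size_cat // take_size_cat //= size_cat /= -!word_cat.
  by rewrite -/(forest_word _) forest_word_cat forest_word_cons !cat_cons catA.
have := IHts (rcons pre t).
rewrite size_rcons cat_rcons addSnnS => ->; last first.
  by move=> u uts; apply: IH; rewrite inE uts orbT.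
have -> : word ((a, (size pre + (size ts).+1)%N) :: forest_word (rcons pre t))
    = w * word (fertility_word t).
  by rewrite -word_cat -cats1 forest_word_cat /forest_word /= cats0.
have -> : T s (word (forest_word (t :: ts)))
    = T s (word (fertility_word t)) * word (forest_word ts)
      + word (fertility_word t) * T s (word (forest_word ts)).
  by rewrite forest_word_cons word_cat tri_w_derivation.
exact: leibniz_mull.
Qed.

(** Grafting s at v as leftmost child puts the word of s right after the letter
    of v, since the children of v are read from left to right after v. *)
Lemma Phi_fer_tree_graft s t :
  Phi (tree_graft s t) = T s (word (fertility_word t)).
Proof.
rewrite /tree_graft linear_sum /=.
under eq_bigr do rewrite Phi_fer_tree.
elim/(@otree_ind_in A): t => a ts IH.
have E := @tri_w_children s a [::] ts IH.
rewrite [vertices _]/= big_cons big_flatten big_map /=.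
under eq_bigr do rewrite big_map.
apply: etrans (congr1 (+%R _) E) _.
apply: etrans _ (esym (tri_w_tree_cons s (a, size ts) (forest_word ts))).
by rewrite /shift /= addn1.
Qed.

Lemma intertwining_subspace :
  subspace (fun x => forall y, Phi (left_graft x y) = tri_w (Phi x) (Phi y)).
Proof.
split=> [y|c x x' E E' y].
  rewrite (act0l left_graft_linearl) (linear0 Phi).
  by rewrite (act0l tri_w_linearl).
rewrite left_graft_linearl !Phi_fer_is_linear tri_w_linearl.
exact: (f_equal2 (fun u v => c *: u + v) (E y) (E' y)).
Qed.

Lemma Phi_fer_left_graft_letter s y :
  Phi (left_graft (word [:: s]) y) = tri_w (Phi (word [:: s])) (Phi y).
Proof.
rewrite Phi_fer_tree left_graft_letter; move: y.
apply: (@derivation_along_ext _ _ WA Phi).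
- by move=> c x y; rewrite (linearP (derivation_of _)) Phi_fer_is_linear.
- by move=> c x y; rewrite Phi_fer_is_linear tri_w_is_linear.
- exact: Phi_fer1.
- move=> x y; rewrite derivation_ofP /= -[_ * y]scale1r Phi_fer_is_linear.
  rewrite scale1r.
  exact: (f_equal2 +%R (Phi_ferM _ _) (Phi_ferM _ _)).
- by move=> x y; rewrite Phi_ferM tri_w_derivation.
- by move=> t; rewrite derivation_of_letter Phi_fer_tree_graft Phi_fer_tree.
Qed.

(** On trees the two sides agree by [Phi_fer_left_graft_letter]; for a bracket
    [u, v] both products are given by the same formula in terms of the actions
    of u, v, u > v and v > u.  The left operand must be a Lie element: for a
    forest of several trees, grafting may distribute them over different
    vertices, whereas insertion keeps the word together. *)
Lemma Phi_fer_left_graft x y : PSL k A x ->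
  Phi (left_graft x y) = tri_w (Phi x) (Phi y).
Proof.
move=> Px; move: x Px y.
have [i0 iL] := intertwining_subspace.
have [d0 dL] := derivation_subspace (@malg_scalerAr k _)
  (@left_graft_linearl k A).
pose Q x := derivation (left_graft x) /\
  forall y, Phi (left_graft x y) = tri_w (Phi x) (Phi y).
suff QP x : PSL k A x -> Q x by move=> x /QP [].
apply: (lie_gen_act_ind (commutator_lie _) (@left_graft_linearr k A)).
- by move=> z s; apply: left_graft_size.
- by move=> z [].
- by split; [exact: d0|exact: i0].
- move=> c u v _ _ [du iu] [dv iv].
  by split; [exact: (dL c u v du dv)|exact: (iL c u v iu iv)].
- move=> u Su; split; first by have [] := left_graft_single Su.
  move: u Su; apply: word_span_ind; first exact: i0.
    by move=> _ /eqP/singleton_seq [s ->] y; apply: Phi_fer_left_graft_letter.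
  by move=> c u v _ _; apply: iL.
move=> u v Lu Lv [du iu] [dv iv] [_ iuv] [_ ivu].
have [au av] := ((left_graft_PSL Lu).2, (left_graft_PSL Lv).2).
split; first by have [] := left_graft_PSL (LieGen_bracket Lu Lv).
move=> y.
have -> : left_graft (ring_commutator u v) y
    = bracket_action (@left_graft k A) u v y.
  by apply: (act_commutatorl (@left_graft_linearl k A)); [apply: au|apply: av].
have -> : Phi (ring_commutator u v) = commutator (Phi u) (Phi v).
  exact: Phi_fer_commutator.
rewrite tri_w_commutator; try exact: Phi_fer_nonpositive.
exact: bracket_action_morphism Phi_fer_is_linear iu iv iuv ivu.
Qed.

Lemma Phi_fer_single x : word_span (fun F => size F == 1%N) x ->
  word_span V_word (Phi x).
Proof.
apply: word_span_linext => [|_ /eqP/singleton_seq [t ->]].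
  exact: word_span_subspace.
by apply: word_span_word; rewrite /= cats0; apply: V_word_fertility.
Qed.

Lemma Phi_fer_gA x : PSL k A x -> gA k A (Phi x).
Proof.
elim=> {x} [x Sx||c x y _ Px _ Py|x y _ Px _ Py].
- exact/LieGen_mem/Phi_fer_single.
- by rewrite (linear0 Phi); apply: LieGen_zero.
- by rewrite Phi_fer_is_linear; exact: (LieGen_linear c Px Py).
- by rewrite Phi_fer_commutator; exact: (LieGen_bracket Px Py).
Qed.

Lemma Phi_fer_onto u : gA k A u -> exists2 x, PSL k A x & Phi x = u.
Proof.
elim=> {u} [u||c _ _ _ [x Px <-] _ [y Py <-]|_ _ _ [x Px <-] _ [y Py <-]].
- move: u; apply: word_span_ind => [|r /V_word_decode [t <-]|].
  + by exists 0; [apply: LieGen_zero|rewrite (linear0 Phi)].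
  + exists (word [:: t]); last exact: Phi_fer_tree.
    exact/LieGen_mem/word_span_word.
  + move=> c _ _ _ _ [x Px <-] [y Py <-].
    exists (c *: x + y); [exact: LieGen_linear|exact: Phi_fer_is_linear].
- by exists 0; [apply: LieGen_zero|rewrite (linear0 Phi)].
- exists (c *: x + y); [exact: LieGen_linear|exact: Phi_fer_is_linear].
- by exists (commutator x y); [apply: LieGen_bracket|apply: Phi_fer_commutator].
Qed.

End FertilityTheory.

Theorem proposition2p16 (k : fieldType) (char0 : [pchar k] =i pred0)
    (A : finType) :
  post_lie_isomorphism (PSL k A) (@left_graft k A) (@commutator k _)
                       (gA k A) (@tri_w k A) (@commutator k _)
                       (@Phi_fer k A).
Proof.
have graftE x y (Px : PSL k A x) := @Phi_fer_left_graft k A x y Px.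
split.
- exact: PSL_post_lie.
- apply: (post_lie_image (@PSL_post_lie k A) (@Phi_fer_is_linear k A)).
  + exact: Phi_fer_gA.
  + exact: Phi_fer_onto.
  + by move=> x y _ _; apply: Phi_fer_commutator.
  + by move=> x y Px _; apply: graftE.
- exact: Phi_fer_gA.
- by move=> c x y _ _; apply: Phi_fer_is_linear.
- by move=> x y _ _; apply: Phi_fer_inj.
- exact: Phi_fer_onto.
- by move=> x y _ _; apply: Phi_fer_commutator.
- by move=> x y Px _; apply: graftE.
Qed.
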